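(* Let $(r_n)_{n\ge 0}$ be an admissible sequence of radii, let $(\omega_{\mathbf i})_{\mathbf i\in[4]^*}$ be any choice of angles in $[0,2\pi]$, and let $K_n$ and $K$ be the associated Cantor sets. Then $$\mathrm{Cap}_1(K_n)\gtrsim\left(\sum_{j=0}^n\frac{1}{4^j r_j}\right)^{-1}\qquad\text{for all } n\ge 0,$$ and $$\mathrm{Cap}_1(K(r))\gtrsim\left(\sum_{j=0}^{n-1}\frac{1}{4^j r_j}+\frac{1}{4^n r}\right)^{-1}\qquad\text{for all } n\ge 0 \text{ and all } r>0 \text{ with } r\in[r_n,r_{n-1}].$$
   Context: Riesz capacity: for a Borel measure $\mu$ on $\mathbb{R}^2$, $I_1(\mu)=\iint\frac{d\mu(x)\,d\mu(y)}{|x-y|}$; for compact $E\subset\mathbb{R}^2$, $\mathrm{Cap}_1(E)=\sup\{I_1(\mu)^{-1}:\mu\text{ a probability measure supported on }E\}$. For a compact set $E$ and $r>0$, $E(r)=\{x:\mathrm{dist}(x,E)\le r\}$. Admissible sequence: a sequence $r_0\ge r_1\ge r_2\ge\cdots$ of nonnegative reals with $r_{n+1}\le \frac13 r_n$ for all $n\ge0$. The degenerate case in which $r_n=0$ for all $n$ from some index on is allowed. Conventions: $r_{-1}=\infty$, $1/0=\infty$, $1/\infty=0$. Cantor set: let $[4]=\{0,1,2,3\}$, let $[4]^*$ be the set of finite words over $[4]$ (including the empty word $\varnothing$), and let $|\mathbf{i}|$ be the length of $\mathbf{i}$. Write $B(x,r)$ for the closed disc and $u(t)=(\cos t,\sin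 t)$. Given an admissible sequence $(r_n)$ and angles $(\omega_{\mathbf i})_{\mathbf i\in[4]^*}$ in $[0,2\pi]$, define $D_\varnothing=B(0,r_0)$, and if $|\mathbf i|=k$ and $D_{\mathbf i}=B(c_{\mathbf i},r_k)$, then for $j\in[4]$ put $D_{\mathbf i j}=B\big(c_{\mathbf i}+(r_k-r_{k+1})\,u(\omega_{\mathbf i}+\tfrac{2\pi j}{4}),\,r_{k+1}\big)$. Set $K_n=\bigcup_{|\mathbf i|=n}D_{\mathbf i}$ and $K=\bigcap_{n\ge0}K_n$. $X\gtrsim Y$ means $X\ge cY$ with an absolute constant $c>0$ (independent of the sequence, the angles, $n$ and $r$). *)

(* Defs.v *)
From HB Require Import structures.
From mathcomp Require Export all_boot all_order all_algebra.
From mathcomp Require Export all_classical all_reals all_analysis.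
Export Order.TTheory GRing.Theory Num.Theory.
Export numFieldNormedType.Exports.

Set Implicit Arguments.
Unset Strict Implicit.
Unset Printing Implicit Defensive.

Local Open Scope classical_set_scope.
Local Open Scope ring_scope.

(* The product sigma-algebra of [plane R] is the Borel sigma-algebra of R^2.
   The library's own norm on [R * R] is the sup norm, hence [enorm] and [edist2]
   for the Euclidean structure. *)
Notation plane R := (measurableTypeR R * measurableTypeR R)%type.

Section Plane.
Context {R : realType}.
Implicit Types (x y : R * R) (E : set (R * R)).

Definition enorm x : R := Num.sqrt (x.1 ^+ 2 + x.2 ^+ 2).

Definition edist2 x y : R := enorm (x - y).

Definition disc (x : R * R) (rho : R) : set (R * R) :=
  [set y | edist2 y x <= rho].

Definition dist_to E x : \bar R := ereal_inf [set (edist2 x y)%:E | y in E].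

Definition nbhd E (rho : R) : set (R * R) :=
  [set x | (dist_to E x <= rho%:E)%E].

Definition unit_vec (t : R) : R * R := (cos t, sin t).

End Plane.

Section Capacity.
Context {R : realType}.
Local Open Scope ereal_scope.

(* [inve] satisfies 0^-1 = +oo and +oo^-1 = 0; in particular the kernel is +oo
   on the diagonal. *)
Definition riesz_energy (mu : {measure set (plane R) -> \bar R}) : \bar R :=
  \int[mu]_y \int[mu]_x ((edist2 x y)%:E)^-1.

(* Meant for compact E, for which mu (~` E) = 0 says that the closed support of
   mu is contained in E.  The supremum is over an empty set iff E is empty. *)
Definition riesz_cap (E : set (plane R)) : \bar R :=
  ereal_sup [set (riesz_energy mu)^-1 |
              mu in [set mu : probability (plane R) R | mu (~` E) = 0]].

End Capacity.

Section CantorSet.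
Context {R : realType}.
Implicit Types (r : nat -> R) (omega : seq 'I_4 -> R).

Definition admissible r : Prop :=
  [/\ forall n, 0 <= r n,
      forall n, r n.+1 <= r n &
      forall n, r n.+1 <= 3^-1 * r n].

Definition angles omega : Prop := forall i, 0 <= omega i <= 2 * pi.

(* The word is stored with its last letter first; see [center_rcons]. *)
Fixpoint center_rev r omega (w : seq 'I_4) : R * R :=
  if w is j :: v then
    center_rev r omega v
      + (r (size v) - r (size v).+1)
          *: unit_vec (omega (rev v) + 2 * pi * j%:R / 4)
  else 0.

Definition center r omega (i : seq 'I_4) : R * R := center_rev r omega (rev i).

Lemma center_nil r omega : center r omega [::] = 0.
Proof. by []. Qed.

Lemma center_rcons r omega i j :
  center r omega (rcons i j) =
  center r omega i
    + (r (size i) - r (size i).+1)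
        *: unit_vec (omega i + 2 * pi * j%:R / 4).
Proof. by rewrite /center rev_rcons /= size_rev revK. Qed.

Definition cdisc r omega (i : seq 'I_4) : set (R * R) :=
  disc (center r omega i) (r (size i)).

Definition cantor_level r omega (n : nat) : set (R * R) :=
  \bigcup_(i in [set i : seq 'I_4 | size i = n]) cdisc r omega i.

Definition cantor_limit r omega : set (R * R) :=
  \bigcap_n cantor_level r omega n.

(* The radius r_(n-1), with r_(-1) = +oo. *)
Definition prev_radius r (n : nat) : \bar R :=
  if n is m.+1 then (r m)%:E else +oo%E.

(* 1 / (4^n rho), equal to +oo for rho = 0. *)
Definition level_term (n : nat) (rho : R) : \bar R :=
  ((4 ^+ n * rho)%:E)^-1%E.

End CantorSet.

(* Main.v *)
From HB Require Import structures.
Require Import Defs.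
From mathcomp Require Import ring lra measurable_realfun.

(** A lower bound for the capacity of [E] is an upper bound for the energy of
    one well-chosen probability measure on [E], and the energy is at most the
    supremum of the potential [y |-> \int |x - y|^-1 dmu(x)] over the plane.

    The measure is the natural one on the tree of words of length [n]: it gives
    mass [4^-n] to each word [w], spread uniformly over a square of side
    comparable to [rho] next to a point [p w] of the disc [D_w].  With
    [p w] the center of [D_w] and [rho = r_n] this measure lives on [K_n]; with
    [p w] a point of [K] in [D_w] ([cantor_limit_meets_cdisc]) it lives on
    [K(rho)].  So both estimates are instances of one statement,
    [riesz_cap_tree].

    The potential is bounded from the leaves to the root
    ([exists_subtree_probability]).  The measure of a word of length [k] is the
    average of the measures of its four children.  The children lie at mutual
    distance comparable to [r_k], because [r_(k+1) <= r_k / 3]; hence every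
    point of the plane, in the support or not, is far from all but one of them
    ([far_from_all_but_one_child]), and the far ones have potential [O(1 / r_k)]
    ([potential_far]).  So the best bounds [U_k] satisfy
    [U_k <= U_(k+1) / 4 + O(1 / r_k)], which unwinds to
    [U_0 <= sum_(k < n) O(1 / (4^k r_k)) + U_n / 4^n].

    At a leaf, the uniform measure on a square of side [s] gives mass at most
    [4 / 4^k] to a disc of radius [s / 2^k].  Summing the kernel over dyadic
    scales ([potential_le_growth]) gives [U_n = O(1 / s) = O(1 / rho)]. *)

Set Implicit Arguments.
Unset Strict Implicit.
Unset Printing Implicit Defensive.

Local Open Scope classical_set_scope.
Local Open Scope ring_scope.

(** * Euclidean geometry of the plane *)

Section PlaneGeometry.
Context {R : realType}.
Implicit Types (x y z : R * R) (a b t : R).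

Lemma enorm_ge0 x : 0 <= enorm x. Proof. exact: sqrtr_ge0. Qed.

Lemma edist2_ge0 x y : 0 <= edist2 x y. Proof. exact: enorm_ge0. Qed.

Lemma enorm_sqr x : enorm x ^+ 2 = x.1 ^+ 2 + x.2 ^+ 2.
Proof. by rewrite sqr_sqrtr// addr_ge0 ?sqr_ge0. Qed.

Lemma enorm_le x b : 0 <= b -> (enorm x <= b) = (x.1 ^+ 2 + x.2 ^+ 2 <= b ^+ 2).
Proof.
by move=> b0; rewrite -enorm_sqr ler_pXn2r// ?nnegrE ?enorm_ge0.
Qed.

Lemma enormN x : enorm (- x) = enorm x.
Proof. by rewrite /enorm !sqrrN. Qed.

Lemma enormD x y : enorm (x + y) <= enorm x + enorm y.
Proof.
rewrite enorm_le ?addr_ge0 ?enorm_ge0//=.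
have CS : x.1 * y.1 + x.2 * y.2 <= enorm x * enorm y.
  apply: (le_trans (ler_norm _)); rewrite -(@ler_pXn2r _ 2)// ?nnegrE//; last first.
    by rewrite mulr_ge0 ?enorm_ge0.
  rewrite real_normK ?num_real// exprMn !enorm_sqr.
  by have := sqr_ge0 (x.1 * y.2 - x.2 * y.1); nra.
have := enorm_sqr x; have := enorm_sqr y; nra.
Qed.

Lemma enormZ a x : 0 <= a -> enorm (a *: x) = a * enorm x.
Proof.
move=> a0; rewrite /enorm/= /GRing.scale/= !exprMn -mulrDr sqrtrM ?sqr_ge0//.
by rewrite sqrtr_sqr ger0_norm.
Qed.

Lemma edist2C x y : edist2 x y = edist2 y x.
Proof. by rewrite /edist2 -enormN opprB. Qed.

Lemma edist2xx x : edist2 x x = 0.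
Proof. by rewrite /edist2 subrr /enorm/= expr0n/= addr0 sqrtr0. Qed.

Lemma edist2_triangle y x z : edist2 x z <= edist2 x y + edist2 y z.
Proof. by rewrite /edist2 (le_trans _ (enormD _ _))// addrA subrK. Qed.

Lemma abs_fst_le_edist2 x y : `|x.1 - y.1| <= edist2 x y.
Proof.
rewrite -(@ler_pXn2r _ 2)// ?nnegrE ?edist2_ge0// /edist2 enorm_sqr.
by rewrite real_normK ?num_real//= lerDl sqr_ge0.
Qed.

Lemma abs_snd_le_edist2 x y : `|x.2 - y.2| <= edist2 x y.
Proof.
rewrite -(@ler_pXn2r _ 2)// ?nnegrE ?edist2_ge0// /edist2 enorm_sqr.
by rewrite real_normK ?num_real//= lerDr sqr_ge0.
Qed.

Lemma disc_sub x y a b : edist2 x y + a <= b -> disc x a `<=` disc y b.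
Proof.
move=> h z /= xz; rewrite /disc/= (le_trans (edist2_triangle x _ _))//.
by rewrite (le_trans _ h)// addrC lerD2l.
Qed.

Lemma enorm_unit_vec t : enorm (unit_vec t) = 1 :> R.
Proof. by rewrite /enorm/= cos2Dsin2 sqrtr1. Qed.

Lemma unit_vec_quarter t (j : 'I_4) :
  unit_vec (t + 2 * pi * j%:R / 4) =
  nth 0 [:: (cos t, sin t); (- sin t, cos t); (- cos t, - sin t);
            (sin t, - cos t)] j :> R * R.
Proof.
rewrite /unit_vec; case: j => -[|[|[|[|//]]]] _ /=.
- by rewrite mulr0 mul0r addr0.
- have -> : 2 * pi * 1 / 4 = pi / 2 :> R by field.
  by rewrite cosDpihalf sinDpihalf.
- have -> : 2 * pi * 2 / 4 = pi :> R by field.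
  by rewrite cosDpi sinDpi.
- have -> : t + 2 * pi * 3 / 4 = t + pi / 2 + pi :> R by field.
  by rewrite cosDpi sinDpi cosDpihalf sinDpihalf opprK.
Qed.

(** The four directions are the vertices of a square of side [sqrt 2]; the
    rational lower bound 7/5 is all that the separation of children uses. *)
Lemma unit_vec_separated t (i j : 'I_4) : i != j ->
  7 / 5 <= enorm (unit_vec (t + 2 * pi * i%:R / 4) -
                  unit_vec (t + 2 * pi * j%:R / 4) : R * R).
Proof.
move=> ij; rewrite -(@ler_pXn2r _ 2)// ?nnegrE ?enorm_ge0//.
rewrite enorm_sqr !unit_vec_quarter; have := cos2Dsin2 t.
by move: ij; case: i j => -[|[|[|[|//]]]] ? [[|[|[|[|//]]]] ?] //= _ h; nra.
Qed.

End PlaneGeometry.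

(** * Riesz potentials of probability measures *)

Section RieszPotential.
Context {R : realType}.
Local Notation M := (plane R).

Lemma measurable_edist2 : measurable_fun [set: M * M]
  (fun z => edist2 z.1 z.2).
Proof.
apply: (measurableT_comp (continuous_measurable_fun (@sqrt_continuous R))).
apply: measurable_funD; apply: measurable_funX; apply: measurable_funB.
all: by repeat first [exact: measurable_fst | exact: measurable_snd
   | apply: measurableT_comp].
Qed.

Lemma measurable_riesz_kernel : measurable_fun [set: M * M]
  (fun z => ((edist2 z.1 z.2)%:E)^-1%E).
Proof.
(* The reciprocal is a real power, and real powers are measurable. *)
pose g t : \bar R := if t == 0 then +oo%E else (t `^ (-1))%:E.
rewrite (_ : (fun z => _) = g \o (fun z : M * M => edist2 z.1 z.2)).
  apply: measurableT_comp; last exact: measurable_edist2.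
  apply: measurable_fun_ifT => //.
    exact: measurable_fun_eqr.
  apply/measurable_EFinP.
  exact: measurable_powR.
apply/funext => z /=; rewrite /g inver; case: ifPn => // _.
by rewrite powR_inv1// edist2_ge0.
Qed.

Local Open Scope ereal_scope.

Definition potential (mu : set M -> \bar R) (y : M) : \bar R :=
  \int[mu]_x ((edist2 x y)%:E)^-1.

Lemma measurable_kernel_at (y : M) :
  measurable_fun [set: M] (fun x : M => ((edist2 x y)%:E)^-1).
Proof.
exact: (measurable_fun_pair1 y measurable_riesz_kernel).
Qed.

Lemma kernel_ge0 (x y : R * R) : 0 <= ((edist2 x y)%:E)^-1.
Proof. by rewrite inve_ge0 lee_fin edist2_ge0. Qed.

Lemma measurable_disc (c : M) (rho : R) : measurable (disc c rho : set M).
Proof.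
rewrite -[disc _ _]setTI; apply: measurable_fun_le => //.
exact: (measurable_fun_pair1 c measurable_edist2).
Qed.

Lemma potential_ge0 (mu : {measure set M -> \bar R}) y : 0 <= potential mu y.
Proof. by apply: integral_ge0 => x _; exact: kernel_ge0. Qed.

Lemma riesz_energy_ge0 (mu : {measure set M -> \bar R}) : 0 <= riesz_energy mu.
Proof. by apply: integral_ge0 => y _; exact: potential_ge0. Qed.

Lemma integral_cst_probability (mu : probability M R) (C : \bar R) :
  \int[mu]_(y in [set: M]) cst C y = C.
Proof.
rewrite integral_cst// -[RHS]mule1; congr (_ * _); exact: probability_setT.
Qed.

(** The energy is the [mu]-average of the potential, and [mu] has mass 1. *)
Lemma riesz_energy_le (mu : probability M R) (C : R) :
  (forall y, potential mu y <= C%:E) -> riesz_energy mu <= C%:E.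
Proof.
move=> UC; have -> : C%:E = \int[mu]_(y in [set: M]) cst C%:E y.
  by rewrite integral_cst_probability.
apply: ge0_le_integral => //.
- by move=> y _; exact: potential_ge0.
- apply: (measurable_fun_fubini_tonelli_G
    (fun z : M * M => ((edist2 z.1 z.2)%:E)^-1)) => [|z]; last exact: kernel_ge0.
  exact: measurable_riesz_kernel.
- by move=> y _; exact: UC.
Qed.

(** The kernel is at most [delta^-1] on the disc that carries [mu]. *)
Lemma potential_far (mu : probability M R) (c y : M) (rho delta : R) :
  mu (~` disc c rho) = 0 -> (0 < delta)%R -> (rho + delta <= edist2 c y)%R ->
  potential mu y <= (delta^-1)%:E.
Proof.
move=> mu0 d0 cy.
have -> : (delta^-1)%:E = \int[mu]_(y in [set: M]) cst (delta^-1)%:E y.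
  by rewrite integral_cst_probability.
apply: ae_ge0_le_integral => //.
- by move=> x _; exact: kernel_ge0.
- exact: measurable_kernel_at.
- by move=> x _; rewrite /= lee_fin invr_ge0 ltW.
- exists (~` disc c rho); split => //.
    by apply: measurableC; exact: measurable_disc.
  move=> x /= /not_implyP[_ xy] xc; apply: xy.
  have dxy : (delta <= edist2 x y)%R.
    have := edist2_triangle x c y; rewrite (edist2C c x).
    by move: xc; rewrite /disc/=; lra.
  rewrite inver gt_eqF ?(lt_le_trans d0)// lee_fin lef_pV2// posrE.
  exact: lt_le_trans dxy.
Qed.

(** Convex combinations of measures, for the step from the four children of a
    word to the word.  The vanishing clause is for arbitrary [A] because the
    capacity evaluates measures on [~` E] without asking [E] to be measurable. *)
Lemma mean_probability (mu : 'I_4 -> probability M R) :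
  exists nu : probability M R,
    (forall A, (forall j, mu j A = 0) -> nu A = 0) /\
    (forall y, potential nu y = 4^-1%:E * \sum_(j < 4) potential (mu j) y).
Proof.
pose m (k : nat) : {measure set M -> \bar R} := mu (inord k).
have q0 : (0 <= 4^-1 :> R)%R by [].
pose nu := mscale (NngNum q0) (msum m 4).
have nu1 : nu setT = 1.
  have -> : nu setT = 4^-1%:E * \sum_(k < 4) m k setT by [].
  rewrite (eq_bigr (fun=> 1)) => [|i _]; last exact: probability_setT.
  by rewrite !big_ord_recr big_ord0/= add0e -!EFinD -EFinM; congr EFin; field.
pose nuP := HB.pack_for (probability M R) nu
  (Measure_isProbability.Build _ _ _ nu nu1).
exists nuP; split => [A A0|y].
  have -> : nuP A = 4^-1%:E * \sum_(k < 4) m k A by [].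
  by rewrite big1 ?mule0// => i _; exact: A0.
rewrite /potential /= ge0_integral_mscale//=; first last.
- by move=> x _; exact: kernel_ge0.
- exact: measurable_kernel_at.
congr (_ * _); rewrite ge0_integral_measure_sum//; first last.
- exact: measurable_kernel_at.
- by move=> x _; exact: kernel_ge0.
by apply: eq_bigr => i _; rewrite /m inord_val.
Qed.

End RieszPotential.

(** * Dyadic bound for the potential *)

Section DyadicDecomposition.
Context {R : realType}.

Lemma dyadic_scale (s t : R) : 0 < t -> t <= s ->
  exists k, (t <= s / 2 ^+ k) && (s / 2 ^+ k.+1 < t).
Proof.
move=> t0 ts.
have ex : exists k, s / 2 ^+ k.+1 < t.
  exists (Num.truncn (s / t)).
  rewrite ltr_pdivrMr ?exprn_gt0// mulrC -ltr_pdivrMr//.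
  rewrite (lt_trans (truncnS_gt _))// -natrX ltr_nat.
  by rewrite (leq_trans (ltn_expl _ (ltnSn 1)))// leq_exp2l.
case: (ex_minnP ex) => -[h _|k h min].
  by exists 0%N; rewrite expr0 divr1 ts h.
by exists k.+1; rewrite h andbT leNgt; apply/negP => /min; rewrite ltnn.
Qed.

(** If [0 < |x - y| <= s], the summand at the dyadic scale of [|x - y|] already
    dominates the kernel; on the diagonal every summand is present and the
    series diverges. *)
Lemma kernel_le_dyadic (s : R) (x y : R * R) : 0 < s ->
  (((edist2 x y)%:E)^-1 <= (s^-1)%:E +
    \sum_(0 <= k <oo) ((2 ^+ k.+1 / s) * \1_(disc y (s / 2 ^+ k)) x)%:E)%E.
Proof.
move=> s0; pose f k := ((2 ^+ k.+1 / s) * \1_(disc y (s / 2 ^+ k)) x)%:E.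
suff : (((edist2 x y)%:E)^-1 <= (s^-1)%:E + \sum_(0 <= k <oo) f k)%E by [].
have f0 k : (0 <= f k)%E.
  by rewrite /f lee_fin mulr_ge0 ?divr_ge0 ?exprn_ge0 ?(ltW s0).
have fS k : (f k <= \sum_(0 <= k <oo) f k)%E.
  apply: le_trans (nneseries_lim_ge k.+1 _) => //.
  by rewrite big_nat_recr//= leeDr// sume_ge0.
have S0 : (0 <= \sum_(0 <= k <oo) f k)%E by exact: nneseries_ge0.
have [d0|dn0] := eqVneq (edist2 x y) 0.
  suff -> : (\sum_(0 <= k <oo) f k = +oo)%E by rewrite addey// leey.
  apply: eq_infty => A; pose k := Num.truncn (`|A| * s).
  apply: le_trans (fS k); rewrite /f lee_fin indicE mem_set; last first.
    by rewrite /disc/= d0 divr_ge0 ?exprn_ge0 ?(ltW s0).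
  rewrite mulr1 ler_pdivlMr// (le_trans (ler_wpM2r (ltW s0) (ler_norm A)))//.
  apply/ltW/(lt_le_trans (truncnS_gt _)); rewrite -natrX ler_nat.
  exact: ltnW (ltn_expl _ _).
have dgt0 : 0 < edist2 x y by rewrite lt_def dn0 edist2_ge0.
rewrite inver (negbTE dn0).
have [sd|ds] := ltP s (edist2 x y).
  by rewrite (le_trans _ (leeDl _ S0))// lee_fin lef_pV2 ?posrE// ltW.
have [k /andP[dk kd]] := dyadic_scale dgt0 ds.
apply: le_trans (leeDr _ _); last by rewrite lee_fin invr_ge0 ltW.
apply: le_trans (fS k); rewrite /f lee_fin indicE mem_set// mulr1.
rewrite -[leRHS]invrK lef_pV2 ?posrE// ?invr_gt0 ?divr_gt0 ?exprn_gt0//.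
by rewrite invf_div ltW.
Qed.

(** Quadratic growth of the mass of discs beats the linear blow-up of the
    kernel: scale [s / 2^k] contributes [2^(k+1) / s * K / 4^k], a geometric
    series of sum [4 K / s]. *)
Lemma potential_le_growth (mu : probability (plane R) R) (y : plane R) (K s : R) :
  0 < s -> 0 <= K ->
  (forall k, mu (disc y (s / 2 ^+ k)) <= (K / 4 ^+ k)%:E)%E ->
  (potential mu y <= ((1 + 4 * K) / s)%:E)%E.
Proof.
move=> s0 K0 growth.
pose f k (x : plane R) := ((2 ^+ k.+1 / s) * \1_(disc y (s / 2 ^+ k)) x)%:E.
have c0 k : 0 <= 2 ^+ k.+1 / s by rewrite divr_ge0 ?exprn_ge0 ?(ltW s0).
have f0 k x : (0 <= f k x)%E by rewrite /f lee_fin mulr_ge0.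
have mD k : measurable (disc y (s / 2 ^+ k) : set (plane R)).
  exact: measurable_disc.
have mf k : measurable_fun [set: plane R] (f k).
  apply/measurable_EFinP/measurable_funM => //.
have mS : measurable_fun [set: plane R] (fun x => \sum_(0 <= k <oo) f k x)%E.
  exact: ge0_emeasurable_sum.
have S0 x : (0 <= \sum_(0 <= k <oo) f k x)%E by exact: nneseries_ge0.
apply: (@le_trans _ _ (\int[mu]_x ((s^-1)%:E + \sum_(0 <= k <oo) f k x))%E).
  apply: ge0_le_integral => //.
  - by move=> x _; exact: kernel_ge0.
  - exact: measurable_kernel_at.
  - exact: emeasurable_funD.
  - by move=> x _; exact: kernel_le_dyadic.
rewrite ge0_integralD//; last by move=> x _; rewrite lee_fin invr_ge0 ltW.
rewrite [X in (X + _)%E](integral_cst_probability mu) mulrDl mul1r EFinD leeD2l//.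
rewrite integral_nneseries//.
have e0 : 0 <= 4 * K / s by rewrite divr_ge0 ?mulr_ge0 ?(ltW s0).
apply: le_trans (epsilon_trick0 xpredT e0).
apply: lee_nneseries => [k _ _|k _]; first exact: integral_ge0.
under eq_integral do rewrite /f EFinM.
rewrite ge0_integralZl//; last 2 first.
  - by apply/measurable_EFinP; exact: measurable_indic.
  - by rewrite lee_fin c0.
rewrite integral_indic// setIT.
apply: le_trans (lee_wpmul2l _ (growth k)) _; first by rewrite lee_fin c0.
rewrite -EFinM lee_fin le_eqVlt; apply/orP; left; apply/eqP.
have -> : 4 ^+ k = 2 ^+ k * 2 ^+ k :> R by rewrite -exprMn; congr (_ ^+ _); ring.
rewrite natrX !exprS; field.
by rewrite expf_neq0 gt_eqF.
Qed.

End DyadicDecomposition.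

(** * Uniform measure on a square *)

Section UniformSquare.
Context {R : realType}.

Definition clamp01 (u : R) : R := Num.max 0 (Num.min u 1).

Lemma clamp01_itv u : 0 <= clamp01 u <= 1.
Proof. by rewrite /clamp01 le_max lexx/= ge_max ler01 ge_min lexx orbT. Qed.

Lemma clamp01_id u : 0 <= u <= 1 -> clamp01 u = u.
Proof.
by move=> /andP[u0 u1]; rewrite /clamp01 (min_idPl u1) (max_idPr u0).
Qed.

Lemma measurable_clamp01 :
  measurable_fun [set: measurableTypeR R] (clamp01 : measurableTypeR R -> R).
Proof. by apply: measurable_maxr => //; exact: measurable_minr. Qed.

(** The range lies in the square even at points outside the unit square.  The
    pushforward by this map thus vanishes on every set that misses the square,
    measurable or not. *)
Definition to_square (p : plane R) (s : R) (z : plane R) : plane R :=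
  (p.1 + s * clamp01 z.1, p.2 + s * clamp01 z.2).

Lemma to_square_disc p s z : 0 <= s -> disc p (2 * s) (to_square p s z).
Proof.
move=> s0; rewrite /disc/= /edist2 enorm_le ?mulr_ge0//=.
have /andP[a0 a1] := clamp01_itv z.1; have /andP[b0 b1] := clamp01_itv z.2.
move: (clamp01 z.1) (clamp01 z.2) a0 a1 b0 b1 => a b a0 a1 b0 b1.
have -> : (p.1 + s * a - p.1) ^+ 2 + (p.2 + s * b - p.2) ^+ 2
  = s ^+ 2 * (a ^+ 2 + b ^+ 2) by ring.
rewrite exprMn mulrC ler_wpM2r ?sqr_ge0//; nra.
Qed.

Lemma measurable_affine_clamp (a s : R) :
  measurable_fun [set: measurableTypeR R] (fun u : measurableTypeR R => a + s * clamp01 u).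
Proof.
apply: measurable_funD => //; apply: measurable_funM => //.
exact: measurable_clamp01.
Qed.

Lemma measurable_to_square p s : measurable_fun [set: plane R] (to_square p s).
Proof.
apply: measurable_fun_pair.
  exact: measurableT_comp (measurable_affine_clamp p.1 s) measurable_fst.
exact: measurableT_comp (measurable_affine_clamp p.2 s) measurable_snd.
Qed.

Local Notation unif := (uniform_prob (@ltr01 R)).

Lemma uniform_prob_le (B : set (measurableTypeR R)) (a b : R) :
  measurable B -> a <= b -> B `&` `[0, 1] `<=` `[a, b] ->
  (unif B <= (b - a)%:E)%E.
Proof.
move=> mB ab Bab; rewrite /uniform_prob integral_uniform_pdf.
have mI : measurable (B `&` `[0, 1]) by exact: measurableI.
apply: (@le_trans _ _ (\int[lebesgue_measure]_(x in B `&` `[0%R, 1%R]) cst 1 x)%E).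
  apply: ge0_le_integral => //.
  - by move=> x _; rewrite lee_fin uniform_pdf_ge0.
  - apply/measurable_EFinP/measurable_funTS; exact: measurable_uniform_pdf.
  - move=> x [_]; rewrite /= in_itv/= => x01.
    by rewrite /uniform_pdf x01 subr0 invr1.
rewrite integral_cst// mul1e (le_trans (le_measure _ _ _ Bab)) ?inE//.
rewrite [X in (X <= _)%E](lebesgue_measure_itv `[a, b]%R)/= lte_fin.
by case: ltP => // _; rewrite lee_fin subr_ge0.
Qed.

Lemma uniform_affine_clamp_le (a s t b : R) : 0 < s -> 0 <= t ->
  (unif [set u | (`|(a + s * clamp01 u) - b| <= t)%R] <= (2 * t / s)%:E)%E.
Proof.
move=> s0 t0.
have -> : 2 * t / s = (b - a + t) / s - (b - a - t) / s.
  by field; rewrite gt_eqF.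
apply: uniform_prob_le.
- rewrite -[X in measurable X]setTI; apply: measurable_fun_le => //.
  apply: measurableT_comp => //; apply: measurable_funB => //.
  exact: measurable_affine_clamp.
- by rewrite ler_pM2r ?invr_gt0//; lra.
- move=> u [/= ubt]; rewrite !in_itv/= => u01; move: ubt.
  by rewrite clamp01_id// ler_pdivrMr// ler_pdivlMr// ler_norml mulrC; lra.
Qed.

(** The uniform probability on a square of side [s] with corner [p]: the set of
    points within [t] of [y] lies in a box of half-side [t], of mass at most
    [(2 t / s)^2], which is the growth hypothesis with [K = 4]. *)
Lemma exists_square_probability (p : plane R) (s : R) : 0 < s ->
  exists mu : probability (plane R) R,
    (forall E, disc p (2 * s) `<=` E -> mu (~` E) = 0%E) /\
    (forall y, (potential mu y <= (17 / s)%:E)%E).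
Proof.
move=> s0.
pose P : probability (plane R) R := (unif \x unif)%E.
pose X : {mfun plane R >-> plane R} :=
  HB.pack (to_square p s) (isMeasurableFun.Build _ _ _ _ (to_square p s)
    (measurable_to_square p s)).
exists (distribution P X); split => [E pE|y].
  suff : P (to_square p s @^-1` (~` E)) = 0%E by [].
  rewrite (_ : _ @^-1` _ = set0) ?measure0//.
  apply/seteqP; split => // z; apply; apply: pE.
  by apply: to_square_disc; exact: ltW.
have -> : 17 / s = (1 + 4 * 4) / s by congr (_ / _); ring.
apply: potential_le_growth => // k.
set t := s / 2 ^+ k.
have t0 : 0 <= t by rewrite divr_ge0 ?exprn_ge0 ?(ltW s0).
pose B (a b : R) := [set u : measurableTypeR R | `|(a + s * clamp01 u) - b| <= t].
have mB a b : measurable (B a b).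
  rewrite -[X in measurable X]setTI; apply: measurable_fun_le => //.
  apply: measurableT_comp => //; apply: measurable_funB => //.
  exact: measurable_affine_clamp.
apply: (@le_trans _ _ (P (B p.1 y.1 `*` B p.2 y.2))).
  suff : (P (to_square p s @^-1` disc y t) <= P (B p.1 y.1 `*` B p.2 y.2))%E by [].
  apply: le_measure; rewrite ?inE.
  - rewrite -[X in measurable X]setTI.
    by apply: measurable_to_square => //; exact: measurable_disc.
  - exact: measurableX.
  - move=> z /= zd; split => /=.
      exact: le_trans (abs_fst_le_edist2 (to_square p s z) y) zd.
    exact: le_trans (abs_snd_le_edist2 (to_square p s z) y) zd.
have -> : P (B p.1 y.1 `*` B p.2 y.2) = (unif (B p.1 y.1) * unif (B p.2 y.2))%E.
  exact: product_measure1E.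
apply: le_trans (lee_pmul _ _ (uniform_affine_clamp_le p.1 y.1 s0 t0)
  (uniform_affine_clamp_le p.2 y.2 s0 t0)) _ => //.
rewrite -EFinM lee_fin le_eqVlt; apply/orP; left; apply/eqP.
have -> : 4 ^+ k = 2 ^+ k * 2 ^+ k :> R by rewrite -exprMn; congr (_ ^+ _); ring.
by rewrite /t; field; rewrite expf_neq0 gt_eqF.
Qed.

End UniformSquare.

(** * Capacity *)

Section CapacityBounds.
Context {R : realType}.
Implicit Type E : set (plane R).

Lemma riesz_cap_ge (mu : probability (plane R) R) E (C : R) :
  0 < C -> mu (~` E) = 0%E -> (forall y, potential mu y <= C%:E)%E ->
  ((C^-1)%:E <= riesz_cap E)%E.
Proof.
move=> C0 muE UC; apply: (@le_trans _ _ (riesz_energy mu)^-1%E).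
  have -> : (C^-1)%:E = (C%:E)^-1%E by rewrite inver gt_eqF.
  by rewrite lee_pV2 ?inE ?riesz_energy_ge0 ?lee_fin ?(ltW C0)// riesz_energy_le.
by apply: ereal_sup_ubound; exists mu.
Qed.

(** A point mass witnesses nonnegativity; the supremum over an empty set of
    measures would be [-oo]. *)
Lemma riesz_cap_ge0 E : E !=set0 -> (0 <= riesz_cap E)%E.
Proof.
move=> [x Ex]; apply: (@le_trans _ _ (riesz_energy (dirac x : probability (plane R) R))^-1%E).
  by rewrite inve_ge0 riesz_energy_ge0.
apply: ereal_sup_ubound; exists (dirac x : probability (plane R) R) => //=.
by rewrite diracE memNset//; apply.
Qed.

End CapacityBounds.

(** * Geometry of the Cantor construction *)

Section CantorGeometry.
Context {R : realType}.
Variables (r : nat -> R) (omega : seq 'I_4 -> R).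
Hypothesis hr : admissible r.
Implicit Types (w : seq 'I_4) (y : plane R).

Let r_ge0 n : 0 <= r n. Proof. by case: hr. Qed.
Let r_dec n : r n.+1 <= r n. Proof. by case: hr. Qed.

Lemma admissible_decreasing m n : (m <= n)%N -> r n <= r m.
Proof.
by move=> mn; apply: (nonincreasing_seqP r).1 => // k; exact: r_dec.
Qed.

Lemma edist2_center_child w j :
  edist2 (center r omega (rcons w j)) (center r omega w) = r (size w) - r (size w).+1.
Proof.
rewrite center_rcons /edist2 addrAC subrr add0r enormZ ?subr_ge0//.
by rewrite enorm_unit_vec mulr1.
Qed.

Lemma children_separated w i j : i != j ->
  7 / 5 * (r (size w) - r (size w).+1)
  <= edist2 (center r omega (rcons w i)) (center r omega (rcons w j)).
Proof.
move=> ij; rewrite !center_rcons /edist2 opprD addrACA subrr add0r -scalerBr.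
rewrite enormZ ?subr_ge0// mulrC ler_wpM2l ?subr_ge0//.
exact: unit_vec_separated.
Qed.

(** Two children with centers strictly within [r_(k+1) + r_k / 8] of [y] would be
    closer to each other than [7/5 (r_k - r_(k+1))]: this is where
    [r_(k+1) <= r_k / 3] enters, as
    [7/5 r_k - 17/5 r_(k+1) >= 4/15 r_k >= r_k / 4]. *)
Lemma far_from_all_but_one_child w y : exists i, forall j, j != i ->
  r (size w).+1 + r (size w) / 8 <= edist2 (center r omega (rcons w j)) y.
Proof.
have [[i hi]|none] := pselect (exists i,
    edist2 (center r omega (rcons w i)) y < r (size w).+1 + r (size w) / 8).
  exists i => j ji; have := children_separated w ji.
  have := edist2_triangle y (center r omega (rcons w j)) (center r omega (rcons w i)).
  rewrite (edist2C y).
  by case: hr => _ _ /(_ (size w)); have := r_ge0 (size w); lra.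
by exists ord0 => j _; rewrite leNgt; apply/negP => h; apply: none; exists j.
Qed.

Lemma center_in_cdisc w : cdisc r omega w (center r omega w).
Proof. by rewrite /cdisc /disc /= edist2xx. Qed.

Lemma edist2_center_descendant w v :
  edist2 (center r omega (w ++ v)) (center r omega w)
    <= r (size w) - r (size w + size v).
Proof.
elim/last_ind: v => [|v j IH]; first by rewrite cats0 addn0 subrr edist2xx.
rewrite -rcons_cat (le_trans (edist2_triangle (center r omega (w ++ v)) _ _))//.
rewrite edist2_center_child size_cat size_rcons addnS; lra.
Qed.

Lemma cdisc_cat w v : cdisc r omega (w ++ v) `<=` cdisc r omega w.
Proof.
apply: disc_sub; rewrite size_cat.
by have := edist2_center_descendant w v; lra.
Qed.

(** The point is the limit of the centers along the word extended by zeros.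
    The center of [D_w] itself need not lie in the limit set: children touch the
    boundary of their parent and may miss its center. *)
Lemma cantor_limit_meets_cdisc w :
  exists p : plane R, cdisc r omega w p /\ cantor_limit r omega p.
Proof.
pose z m := w ++ nseq m (ord0 : 'I_4).
pose c m := center r omega (z m); pose rho m := r (size w + m)%N.
have zD m l : z (m + l)%N = z m ++ nseq l ord0 by rewrite /z nseqD catA.
have sz m : size (z m) = (size w + m)%N by rewrite size_cat size_nseq.
have cD m l : edist2 (c (m + l)%N) (c m) <= rho m - rho (m + l)%N.
  have := edist2_center_descendant (z m) (nseq l ord0).
  by rewrite -zD sz size_nseq -addnA.
have rho_ge0 m : 0 <= rho m by exact: r_ge0.
have rho_cvg : cvgn rho.
  apply: nonincreasing_is_cvgn.
    by apply/nonincreasing_seqP => n; rewrite /rho addnS.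
  by exists 0 => _ [n _ <-].
have coord_cvg (u : nat -> R) :
    (forall m l, `|u (m + l)%N - u m| <= rho m - rho (m + l)%N) -> cvgn u.
  (* The oscillation bound makes [u + rho] nonincreasing. *)
  move=> hu; rewrite (_ : u = (u \+ rho) \- rho); last first.
    by apply/funext => n /=; rewrite addrK.
  apply: is_cvgB => //; apply: nonincreasing_is_cvgn.
    apply/nonincreasing_seqP => n; have := hu n 1%N; rewrite addn1 ler_norml/=; lra.
  exists (u 0%N - rho 0%N) => _ [n _ <-]; have := hu 0%N n.
  by rewrite add0n ler_norml/=; have := rho_ge0 n; lra.
have c1 : cvgn (fun n => (c n).1).
  by apply: coord_cvg => m l; exact: le_trans (abs_fst_le_edist2 _ _) (cD m l).
have c2 : cvgn (fun n => (c n).2).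
  by apply: coord_cvg => m l; exact: le_trans (abs_snd_le_edist2 _ _) (cD m l).
pose p : plane R := (limn (fun n => (c n).1), limn (fun n => (c n).2)).
have pz m : cdisc r omega (z m) p.
  rewrite /cdisc/disc/= sz -/(c m) -/(rho m) /edist2 enorm_le//.
  have sq_cvg (u : nat -> R) (a : R) : cvgn u ->
      (fun n => (u n - a) ^+ 2) @ \oo --> (limn u - a) ^+ 2.
    move=> cu; rewrite expr2; under eq_fun do rewrite expr2.
    by apply: cvgM; apply: cvgB => //; exact: cvg_cst.
  have lim : (fun n => ((c n).1 - (c m).1) ^+ 2 + ((c n).2 - (c m).2) ^+ 2) @ \oo
      --> (p.1 - (c m).1) ^+ 2 + (p.2 - (c m).2) ^+ 2.
    by apply: cvgD; exact: sq_cvg.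
  rewrite -(cvg_lim _ lim)//; apply: limr_le; first exact: cvgP lim.
  near=> n; rewrite -[n](@subnKC m); last by near: n; exact: nbhs_infty_ge.
  have := cD m (n - m)%N; move: (c _) => q qm.
  have : edist2 q (c m) <= rho m by rewrite (le_trans qm)// gerBl.
  by rewrite /edist2 enorm_le.
exists p; split; first by have := pz 0%N; rewrite /z cats0.
move=> N _; have [kN|Nk] := leqP (size w) N.
  exists (z (N - size w)%N); last exact: pz.
  by rewrite /= sz subnKC.
exists (take N w); first by rewrite /= size_takel// ltnW.
apply: (@cdisc_cat _ (drop N w)); rewrite cat_take_drop.
by have := pz 0%N; rewrite /z cats0.
Unshelve. all: by end_near. Qed.

End CantorGeometry.

(** * Measure on the tree of words *)

Section TreeMeasure.
Context {R : realType}.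
Variables (r : nat -> R) (omega : seq 'I_4 -> R).
Hypothesis hr : admissible r.
Variables (n : nat) (rho : R) (p : seq 'I_4 -> plane R) (E : set (plane R)).
Hypothesis rho_gt0 : 0 < rho.
Hypothesis rho_le : forall k, (k < n)%N -> rho <= r k.
Hypothesis p_cdisc : forall w, size w = n -> cdisc r omega w (p w).
Hypothesis p_nbhd : forall w, size w = n -> disc (p w) rho `<=` E.

(** Normalized so that the recursion from level [k + 1] to level [k] only adds a
    term: the potential of the measure of a word of length [k] is compared with
    [4^k * energy_tail k]. *)
Definition energy_tail k : R :=
  \sum_(k <= j < n) (4 ^+ j * r j)^-1 + (4 ^+ n * rho)^-1.

Lemma energy_tail_gt0 k : 0 < energy_tail k.
Proof.
rewrite ltr_wpDl ?invr_gt0 ?mulr_gt0 ?exprn_gt0// sumr_ge0// => j _.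
by rewrite invr_ge0 mulr_ge0 ?exprn_ge0//; case: hr.
Qed.

(** The disc in the second clause is what separates siblings: enlarging [D_w] by
    [rho / 16 <= r_k / 16] leaves half of the gap [r_k / 8] of
    [far_from_all_but_one_child], so far children have potential at most
    [16 / r_k].  The potential is bounded on the whole plane, which lets the
    induction hypothesis for a child be used at every point. *)
Lemma exists_subtree_probability m w : (size w + m)%N = n ->
  exists mu : probability (plane R) R,
    [/\ mu (~` E) = 0%E,
        mu (~` disc (center r omega w) (r (size w) + rho / 16)) = 0%E &
        forall y, (potential mu y
          <= (4 ^+ size w * (544 * energy_tail (size w)))%:E)%E].
Proof.
elim: m w => [|m IH] w swm.
  have sw : size w = n by rewrite -swm addn0.
  (* A square of side [rho / 32] fits in a disc of radius [rho / 16], and its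
     potential is at most [17 / (rho / 32) = 544 / rho]. *)
  have s0 : 0 < rho / 32 by rewrite divr_gt0.
  have [mu [mu0 Umu]] := exists_square_probability (p w) s0.
  exists mu; split=> [||y].
  - apply: mu0; apply: subset_trans (p_nbhd sw); apply: disc_sub.
    by rewrite edist2xx; have := rho_gt0; lra.
  - apply: mu0; apply: disc_sub; have := p_cdisc sw; rewrite /cdisc/disc/=; lra.
  - apply: le_trans (Umu y) _; rewrite lee_fin /energy_tail sw big_geq// add0r.
    rewrite le_eqVlt; apply/orP; left; apply/eqP; field.
    by rewrite expf_neq0//= gt_eqF.
have swn : (size w < n)%N by rewrite -swm -addSnnS leq_addr.
have rw0 : 0 < r (size w) by rewrite (lt_le_trans rho_gt0)// rho_le.
have /choice[mu hmu] : forall j, exists mu : probability (plane R) R,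
    [/\ mu (~` E) = 0%E,
        mu (~` disc (center r omega (rcons w j)) (r (size w).+1 + rho / 16)) = 0%E &
        forall y, (potential mu y
          <= (4 ^+ (size w).+1 * (544 * energy_tail (size w).+1))%:E)%E].
  by move=> j; have := IH (rcons w j); rewrite size_rcons addSnnS; exact.
have [nu [nu0 Unu]] := mean_probability mu.
exists nu; split=> [||y].
- by apply: nu0 => j; have [] := hmu j.
- apply: nu0 => j; have [_ mu0 _] := hmu j.
  apply: subset_measure0 mu0; try by apply: measurableC; exact: measurable_disc.
  apply: subsetC; apply: disc_sub; rewrite edist2_center_child//; lra.
have [i far] := far_from_all_but_one_child omega hr w y.
have Ufar j : j != i -> (potential (mu j) y <= ((r (size w) / 16)^-1)%:E)%E.
  move=> /far fj; have [_ mu0 _] := hmu j; apply: (potential_far mu0).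
    by rewrite divr_gt0.
  by apply: le_trans fj; have := rho_le swn; lra.
(* The near child [i] keeps its own bound; the three others cost [16 / r_k] each,
   and [3 * 16 / 4 <= 544]. *)
rewrite Unu (bigD1 i)//=.
have [_ _ Ui] := hmu i.
apply: (@le_trans _ _ (4^-1%:E * ((4 ^+ (size w).+1 * (544 * energy_tail (size w).+1))%:E
    + \sum_(j < 4 | j != i) ((r (size w) / 16)^-1)%:E))%E).
  by rewrite lee_wpmul2l//; apply: leeD => //; exact: lee_sum.
rewrite sumEFin -EFinD -EFinM lee_fin big_const cardC1 card_ord /= addr0.
have -> : energy_tail (size w) = (4 ^+ size w * r (size w))^-1 + energy_tail (size w).+1.
  by rewrite /energy_tail big_ltn// addrA.
have -> : 4 ^+ size w * (544 * ((4 ^+ size w * r (size w))^-1 + energy_tail (size w).+1))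
   = 544 / r (size w) + 4 ^+ size w * (544 * energy_tail (size w).+1).
  by field; rewrite expf_neq0//= gt_eqF.
rewrite exprS invfM invrK.
have : 0 < (r (size w))^-1 by rewrite invr_gt0.
lra.
Qed.

Lemma riesz_cap_tree :
  ((544^-1)%:E * (\sum_(0 <= j < n) level_term j (r j) + level_term n rho)^-1
    <= riesz_cap E)%E.
Proof.
have [mu [muE _ Umu]] := @exists_subtree_probability n [::] erefl.
have T0 := energy_tail_gt0 0.
rewrite (_ : (_ + _)%E = (energy_tail 0)%:E); last first.
  rewrite /energy_tail EFinD -sumEFin /level_term inver gt_eqF ?mulr_gt0 ?exprn_gt0//.
  congr (_ + _)%E; rewrite !big_nat; apply: eq_bigr => j jn.
  by rewrite inver gt_eqF// mulr_gt0 ?exprn_gt0// (lt_le_trans rho_gt0)// rho_le.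
rewrite inver gt_eqF// -EFinM -invfM.
apply: riesz_cap_ge muE _; first by rewrite mulr_gt0 ?ltr0n.
by move=> y; have := Umu y; rewrite expr0 mul1r.
Qed.

End TreeMeasure.

(** * Capacity of the approximations and neighborhoods *)

Theorem lemma1p5 (R : realType) :
  exists c : R, 0 < c /\
    forall (r : nat -> R) (omega : seq 'I_4 -> R),
      admissible r -> angles omega ->
      (forall n : nat,
         (c%:E * (\sum_(0 <= j < n.+1) level_term j (r j))^-1
            <= riesz_cap (cantor_level r omega n))%E)
      /\
      (forall (n : nat) (rho : R),
         0 < rho -> r n <= rho -> (rho%:E <= prev_radius r n)%E ->
         (c%:E * (\sum_(0 <= j < n) level_term j (r j)
                    + level_term n rho)^-1
            <= riesz_cap (nbhd (cantor_limit r omega) rho))%E).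
Proof.
exists 544^-1; split; first by rewrite invr_gt0 ltr0n.
move=> r omega hr _; have [r0 rdec _] := hr; split=> [n|n rho rho0 _ rho_prev].
  rewrite big_nat_recr//=; have [rn0|rn0] := ltP 0 (r n).
    apply: (riesz_cap_tree (omega := omega) hr rn0 (p := center r omega)).
    - by move=> k kn; apply: (admissible_decreasing hr); exact: ltnW.
    - by move=> w _; exact: (center_in_cdisc omega hr).
    - by move=> w <- x wx; exists w.
  (* If [r_n = 0], the bound to prove is [0]. *)
  have -> : level_term n (r n) = +oo%E.
    have -> : r n = 0 by apply/eqP; rewrite eq_le rn0 r0.
    by rewrite /level_term mulr0 inve0.
  rewrite addey; last first.
    rewrite gt_eqF// (lt_le_trans ltNy0)// sume_ge0// => j _.
    by rewrite inve_ge0 lee_fin mulr_ge0 ?exprn_ge0.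
  rewrite invey mule0; apply: riesz_cap_ge0.
  exists (center r omega (nseq n ord0)), (nseq n ord0); first exact: size_nseq.
  exact: (center_in_cdisc omega hr).
have /choice[p hp] := cantor_limit_meets_cdisc omega hr.
apply: (riesz_cap_tree (omega := omega) hr rho0 (p := p)).
- case: n rho_prev => // n; rewrite /= lee_fin => rhon k kn.
  by apply: le_trans rhon _; apply: (admissible_decreasing hr).
- by move=> w _; have [] := hp w.
- move=> w _ x wx; apply: (@le_trans _ _ (edist2 x (p w))%:E); last by rewrite lee_fin.
  by apply: ereal_inf_lbound; exists (p w); [have [] := hp w|].
Qed.
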